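(* Let $n\ge 2$, let $X_1,\dots,X_n$ be complex Banach spaces, and let $D_1\in\mathcal{B}(X_1),\ D_2\in\mathcal{B}(X_2),\dots,D_n\in\mathcal{B}(X_n)$. Assume that $D_s-\lambda$ is regular for every $2\le s\le n-1$ and every $\lambda\in\mathbb{C}$. Then $$\bigcap_{A\in\mathcal{B}_n}\sigma(T_n^d(A))\subseteq\sigma_l(D_1)\cup\sigma_r(D_n)\cup\Big(\bigcup_{k=1}^{n-1}\Delta_k'\Big),$$ where $$\Delta_k'=\{\lambda\in\mathbb{C}:\ \mathcal{N}(D_{k+1}-\lambda)\cong\mathcal{K}(D_k-\lambda)\text{ does not hold}\},\quad 1\le k\le n-1.$$ If moreover $X_1,\dots,X_n$ are infinite dimensional Hilbert spaces, then $$\sigma_l(D_1)\cup\sigma_r(D_n)\cup\Big(\bigcup_{k=2}^{n-1}\Delta_k\Big)\cup\Delta_n\subseteq\bigcap_{A\in\mathcal{B}_n}\sigma(T_n^d(A)),$$ where, for $2\le k\le n-1$, $$\Delta_k=\Big\{\lambda\in\mathbb{C}:\ \bigoplus_{s=1}^{k-1}\mathcal{K}(D_s-\lambda)\prec\mathcal{N}(D_k-\lambda)\text{ holds}\Big\}\cup\Big\{\lambda\in\mathbb{C}:\ \bigoplus_{s=k+1}^{n}\mathcal{N}(D_s-\lambda)\prec\mathcal{K}(D_k-\lambda)\text{ holds}\Big\},$$ and $$\Delta_n=\Big\{\lambda\in\mathbb{C}:\ \bigoplus_{s=1}^{n-1}\mathcal{K}(D_s-\lambda)\prec\mathcal{N}(D_n-\lambda)\text{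 holds}\Big\}\cup\Big\{\lambda\in\mathbb{C}:\ \bigoplus_{s=2}^{n}\mathcal{N}(D_s-\lambda)\prec\mathcal{K}(D_1-\lambda)\text{ holds}\Big\}.$$
   Context: For Banach spaces $X,Y$, $\mathcal{B}(X,Y)$ is the set of bounded linear operators from $X$ to $Y$, and $\mathcal{B}(X)=\mathcal{B}(X,X)$. $\mathcal{N}(T)$ and $\mathcal{R}(T)$ denote the kernel and the range of $T$. $D-\lambda$ means $D-\lambda I$. $X\cong Y$ means that there is an invertible operator in $\mathcal{B}(X,Y)$. No separability is assumed. Given $D_i\in\mathcal{B}(X_i)$, $1\le i\le n$, let $\mathcal{B}_n$ be the set of all tuples $A=(A_{ij})_{1\le i<j\le n}$ with $A_{ij}\in\mathcal{B}(X_j,X_i)$. For $A\in\mathcal{B}_n$, $T_n^d(A)\in\mathcal{B}(X_1\oplus\cdots\oplus X_n)$ is the upper triangular $n\times n$ operator matrix with diagonal entries $D_1,\dots,D_n$, with $(i,j)$ entry $A_{ij}$ for $i<j$, and with $(i,j)$ entry $0$ for $i>j$. An operator $T\in\mathcal{B}(X,Y)$ is left (right) invertible if $ST=I$ ($TS=I$) for some $S\in\mathcal{B}(Y,X)$. $\mathcal{G}_l(X)$ and $\mathcal{G}_r(X)$ are the sets of left, respectively right, invertible operators in $\mathcal{B}(X)$, and $\mathcal{G}(X)=\mathcal{G}_l(X)\cap\mathcal{G}_r(X)$. For $T\in\mathcal{B}(X)$: $\sigma_l(T)=\{\lambda\in\mathbb{C}:\lambda-T\notin\mathcal{G}_l(X)\}$,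 $\sigma_r(T)=\{\lambda\in\mathbb{C}:\lambda-T\notin\mathcal{G}_r(X)\}$, $\sigma(T)=\{\lambda\in\mathbb{C}:\lambda-T\notin\mathcal{G}(X)\}$. $T\in\mathcal{B}(X)$ is (inner) regular if $T=T\widetilde{T}T$ for some $\widetilde{T}\in\mathcal{B}(X)$; equivalently, $\mathcal{N}(T)$ and $\mathcal{R}(T)$ are closed and complemented subspaces of $X$. For $T\in\mathcal{B}(X)$ such that $\overline{\mathcal{R}(T)}$ is complemented in $X$, $\mathcal{K}(T)$ denotes a topological complement of $\overline{\mathcal{R}(T)}$ in $X$ (unique up to isomorphism; in a Hilbert space one may take $\mathcal{R}(T)^\perp$). In the first inclusion, any $\lambda$ for which $\mathcal{K}(D_1-\lambda)$ does not exist lies in $\sigma_l(D_1)$, so how $\Delta_1'$ is read at such $\lambda$ is immaterial. For Banach spaces $X,Y$, write $X\preceq Y$ if there is a left invertible operator from $X$ to $Y$. Write $X\prec Y$ if $X\preceq Y$ and $Y/\mathcal{R}(T)$ is an infinite dimensional linear space for every $T\in\mathcal{B}(X,Y)$. (If $X,Y$ are Hilbert spaces, then $X\preceq Y$ iff $\dim X\le\dim Y$, and $X\prec Y$ iff $\dim X<\dim Y$ and $\dim Y=\infty$, where $\dim$ is the orthogonal dimension.) *)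

(* Defs.v *)
From HB Require Import structures.
From mathcomp Require Import all_boot all_order all_algebra.
From mathcomp Require Import complex.
From mathcomp Require Import boolp classical_sets functions reals topology.
From mathcomp Require Import normedtype.

Set Implicit Arguments.
Unset Strict Implicit.
Unset Printing Implicit Defensive.

Import Order.TTheory GRing.Theory Num.Theory.
Import numFieldNormedType.Exports.

Local Open Scope classical_set_scope.
Local Open Scope ring_scope.

Section BoundedOperators.
Variable K : numFieldType.

Record bounded_op (X Y : normedModType K) := BoundedOp {
  bounded_op_linear :> {linear X -> Y};
  bounded_opP : bounded_near bounded_op_linear (nbhs (0 : X)) }.

Lemma bounded_op_bound (X Y : normedModType K) (T : bounded_op X Y) :
  exists2 M : K, 0 <= M & forall x, `|T x| <= M * `|x|.
Proof.
have /linear_boundedP/pinfty_ex_gt0[M M0 HM] := bounded_opP T.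
by exists M => //; exact: ltW.
Qed.

Lemma bounded_near_of_bound (X Y : normedModType K) (T : {linear X -> Y})
    (M : K) :
  0 <= M -> (forall x, `|T x| <= M * `|x|) -> bounded_near T (nbhs (0 : X)).
Proof.
move=> M0 HM; apply/linear_boundedP; near=> r => x.
apply: le_trans (HM x) _; apply: ler_wpM2r => //.
by near: r; apply: nbhs_pinfty_ge; exact: ger0_real.
Unshelve. all: by end_near. Qed.

Section Difference.
Variables (X Y : normedModType K) (S T : bounded_op X Y).

Lemma bounded_op_sub_subproof :
  bounded_near ((S \- T : {linear X -> Y}) : X -> Y) (nbhs (0 : X)).
Proof.
have [a a0 Ha] := bounded_op_bound S; have [b b0 Hb] := bounded_op_bound T.
apply: (@bounded_near_of_bound _ _ _ (a + b)) => [|x /=]; first exact: addr_ge0.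
by rewrite mulrDl (le_trans (ler_normB _ _))// lerD.
Qed.

Definition bounded_op_sub : bounded_op X Y := BoundedOp bounded_op_sub_subproof.

End Difference.

Section Scalar.
Variables (X : normedModType K) (l : K).

Lemma scalar_op_subproof :
  bounded_near ((l \*: idfun : {linear X -> X}) : X -> X) (nbhs (0 : X)).
Proof.
by apply: (@bounded_near_of_bound _ _ _ `|l|) => // x /=; rewrite normrZ.
Qed.

Definition scalar_op : bounded_op X X := BoundedOp scalar_op_subproof.

End Scalar.

End BoundedOperators.

Notation "''B' ( X , Y )" := (bounded_op X Y)
  (at level 8, format "''B' ( X ,  Y )") : type_scope.
Notation "S \-o T" := (bounded_op_sub S T)
  (at level 50, left associativity) : ring_scope.
Notation "l %:op" := (scalar_op _ l) (at level 2, format "l %:op") : ring_scope.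

Section Invertibility.
Variable K : numFieldType.

Definition left_invertible (X Y : normedModType K) (T : 'B(X, Y)) : Prop :=
  exists S : 'B(Y, X), forall x, S (T x) = x.

Definition right_invertible (X Y : normedModType K) (T : 'B(X, Y)) : Prop :=
  exists S : 'B(Y, X), forall y, T (S y) = y.

Definition invertible (X Y : normedModType K) (T : 'B(X, Y)) : Prop :=
  left_invertible T /\ right_invertible T.

Definition left_spectrum (X : normedModType K) (T : 'B(X, X)) : set K :=
  [set l | ~ left_invertible (l%:op \-o T)].

Definition right_spectrum (X : normedModType K) (T : 'B(X, X)) : set K :=
  [set l | ~ right_invertible (l%:op \-o T)].

Definition spectrum (X : normedModType K) (T : 'B(X, X)) : set K :=
  [set l | ~ invertible (l%:op \-o T)].

Definition regular (X : normedModType K) (T : 'B(X, X)) : Prop :=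
  exists S : 'B(X, X), forall x, T x = T (S (T x)).

Definition isomorphic (X Y : normedModType K) : Prop :=
  exists T : 'B(X, Y), invertible T.

Definition embeds (X Y : normedModType K) : Prop :=
  exists T : 'B(X, Y), left_invertible T.

(* The quotient linear space X / V is spanned by finitely many classes. *)
Definition finite_codim (X : normedModType K) (V : set X) : Prop :=
  exists (m : nat) (e : 'I_m -> X),
    forall x, exists c : 'I_m -> K, V (x - \sum_(i < m) c i *: e i).

Definition finite_dim (X : normedModType K) : Prop :=
  finite_codim [set 0 : X].

Definition strictly_embeds (X Y : normedModType K) : Prop :=
  embeds X Y /\ forall T : 'B(X, Y), ~ finite_codim (range T).

End Invertibility.

Section Subspaces.
Variable K : numFieldType.

Section NormedSubspace.
Variables (X : normedModType K) (V : submodClosed X).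

Definition subspace_type : Type := {x : X | x \in V}.

HB.instance Definition _ := SubChoice.on subspace_type.
HB.instance Definition _ := [SubChoice_isSubLmodule of subspace_type by <:].

Let subspace_norm (x : subspace_type) : K := `|val x|.

Let subspace_normD x y :
  subspace_norm (x + y) <= subspace_norm x + subspace_norm y.
Proof. by rewrite /subspace_norm raddfD ler_normD. Qed.

Let subspace_normZ l x : subspace_norm (l *: x) = `|l| * subspace_norm x.
Proof. by rewrite /subspace_norm linearZ normrZ. Qed.

Let subspace_norm0 x : subspace_norm x = 0 -> x = 0.
Proof. by move=> /normr0_eq0 x0; apply: val_inj; rewrite x0 raddf0. Qed.

HB.instance Definition _ := Lmodule_isNormed.Build K subspace_type
  subspace_normD subspace_normZ subspace_norm0.

End NormedSubspace.

Section Kernel.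
Variables (X Y : normedModType K) (T : 'B(X, Y)).

Definition kernel_pred : {pred X} := fun x => T x == 0.

Lemma kernel_submod_closed : submod_closed kernel_pred.
Proof.
split=> [|a x y]; rewrite !unfold_in /kernel_pred ?linear0 //.
by move=> /eqP Tx /eqP Ty; rewrite linearP Tx Ty scaler0 addr0.
Qed.

HB.instance Definition _ :=
  GRing.isSubmodClosed.Build K X kernel_pred kernel_submod_closed.

Definition kernel : submodClosed X := kernel_pred.

End Kernel.

(* X is the topological direct sum of V and W: every x decomposes uniquely as
   x = P x + (x - P x) with P x in V and x - P x in W, and the projection P is
   bounded. *)
Definition topological_complement (X : normedModType K) (V : set X)
    (W : submodClosed X) : Prop :=
  (forall x, V x -> x \in W -> x = 0) /\
  exists P : 'B(X, X), forall x, V (P x) /\ x - P x \in W.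

(* A chosen topological complement of the closure of the range of T; it is the
   zero subspace when that closure is not complemented. *)
Definition range_complement (X Y : normedModType K) (T : 'B(X, Y)) :
    submodClosed Y :=
  if pselect (exists W, topological_complement (closure (range T)) W)
    is left exW then sval (cid exW) else kernel (1%:op : 'B(Y, Y)).

End Subspaces.

Notation "''N' ( T )" := (subspace_type (kernel T))
  (at level 8, format "''N' ( T )") : type_scope.
Notation "''K' ( T )" := (subspace_type (range_complement T))
  (at level 8, format "''K' ( T )") : type_scope.

Section DirectSum.
Variables (K : numFieldType) (I : finType) (X : I -> normedModType K).

(* The l^1 sum; the choice among the usual product norms is immaterial, since
   they are equivalent. *)
Definition dsum : Type := forall i, X i.

HB.instance Definition _ := Choice.copy dsum (forall i, X i).

Definition dsum_zero : dsum := fun=> 0.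
Definition dsum_opp (x : dsum) : dsum := fun i => - x i.
Definition dsum_add (x y : dsum) : dsum := fun i => x i + y i.
Definition dsum_scale (l : K) (x : dsum) : dsum := fun i => l *: x i.

Let dsum_addA : associative dsum_add.
Proof. by move=> x y z; apply: functional_extensionality_dep => i; apply: addrA. Qed.
Let dsum_addC : commutative dsum_add.
Proof. by move=> x y; apply: functional_extensionality_dep => i; apply: addrC. Qed.
Let dsum_add0 : left_id dsum_zero dsum_add.
Proof. by move=> x; apply: functional_extensionality_dep => i; apply: add0r. Qed.
Let dsum_addN : left_inverse dsum_zero dsum_opp dsum_add.
Proof. by move=> x; apply: functional_extensionality_dep => i; apply: addNr. Qed.

HB.instance Definition _ :=
  GRing.isZmodule.Build dsum dsum_addA dsum_addC dsum_add0 dsum_addN.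

Let dsum_scaleA (a b : K) (x : dsum) :
  dsum_scale a (dsum_scale b x) = dsum_scale (a * b) x.
Proof. by apply: functional_extensionality_dep => i; apply: scalerA. Qed.
Let dsum_scale1 : left_id 1 dsum_scale.
Proof. by move=> x; apply: functional_extensionality_dep => i; apply: scale1r. Qed.
Let dsum_scaleDr : right_distributive dsum_scale +%R.
Proof. by move=> a x y; apply: functional_extensionality_dep => i; apply: scalerDr. Qed.
Let dsum_scaleDl (x : dsum) : {morph dsum_scale^~ x : a b / a + b}.
Proof. by move=> a b; apply: functional_extensionality_dep => i; apply: scalerDl. Qed.

HB.instance Definition _ := GRing.Zmodule_isLmodule.Build K dsum
  dsum_scaleA dsum_scale1 dsum_scaleDr dsum_scaleDl.

Definition dsum_norm (x : dsum) : K := \sum_i `|x i|.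

Let dsum_normD (x y : dsum) : dsum_norm (x + y) <= dsum_norm x + dsum_norm y.
Proof.
by rewrite /dsum_norm -big_split; apply: ler_sum => i _; apply: ler_normD.
Qed.

Let dsum_normZ (l : K) (x : dsum) : dsum_norm (l *: x) = `|l| * dsum_norm x.
Proof. by rewrite /dsum_norm mulr_sumr; apply: eq_bigr => i _; apply: normrZ. Qed.

Let dsum_norm0 (x : dsum) : dsum_norm x = 0 -> x = 0.
Proof.
move=> /eqP; rewrite psumr_eq0// => /allP x0.
apply: functional_extensionality_dep => i; apply/normr0_eq0/eqP.
exact: x0 (mem_index_enum i).
Qed.

HB.instance Definition _ := Lmodule_isNormed.Build K dsum
  dsum_normD dsum_normZ dsum_norm0.

End DirectSum.

Section UpperTriangular.
Variables (K : numFieldType) (n : nat) (X : 'I_n -> normedModType K).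
Variables (D : forall i, 'B(X i, X i)) (A : forall i j, 'B(X j, X i)).

(* Only the entries A i j with i < j are used. *)
Definition upper_triangular_fun (x : dsum X) : dsum X :=
  fun i => D i (x i) + \sum_(j < n | (i < j)%N) A i j (x j).

Lemma upper_triangular_linear : linear upper_triangular_fun.
Proof.
move=> a x y; apply: functional_extensionality_dep => i.
rewrite /upper_triangular_fun /=.
have -> : \sum_(j < n | (i < j)%N) A i j ((a *: x + y) j) =
    a *: (\sum_(j < n | (i < j)%N) A i j (x j)) +
    \sum_(j < n | (i < j)%N) A i j (y j).
  rewrite scaler_sumr -big_split; apply: eq_bigr => j _.
  exact: (linearP (A i j)).
rewrite [D i _](linearP (D i) a (x i) (y i)) addrACA -scalerDr.
by [].
Qed.

HB.instance Definition _ := GRing.isLinear.Build K (dsum X) (dsum X) *:%R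
  upper_triangular_fun upper_triangular_linear.

Lemma upper_triangular_bounded :
  bounded_near upper_triangular_fun (nbhs (0 : dsum X)).
Proof.
have /choice[d dP] : forall i, exists M : K,
    0 <= M /\ forall x, `|D i x| <= M * `|x|.
  by move=> i; have [M] := bounded_op_bound (D i); exists M.
have /choice[a aP] : forall ij : 'I_n * 'I_n, exists M : K,
    0 <= M /\ forall x, `|A ij.1 ij.2 x| <= M * `|x|.
  by move=> ij; have [M] := bounded_op_bound (A ij.1 ij.2); exists M.
have xN (x : dsum X) i : `|x i| <= `|x|.
  by rewrite [leRHS](bigD1 i)//= lerDl sumr_ge0.
apply: (@bounded_near_of_bound _ _ _ _
  (\sum_i (d i + \sum_(j < n | (i < j)%N) a (i, j)))).
  apply: sumr_ge0 => i _; apply: addr_ge0; first exact: (dP i).1.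
  by apply: sumr_ge0 => j _; exact: (aP (i, j)).1.
move=> x; rewrite mulr_suml; apply: ler_sum => i _.
rewrite mulrDl (le_trans (ler_normD _ _))// lerD//.
  by rewrite (le_trans ((dP i).2 _))// ler_wpM2l//; exact: (dP i).1.
rewrite mulr_suml (le_trans (ler_norm_sum _ _ _))//; apply: ler_sum => j _.
rewrite (le_trans ((aP (i, j)).2 _))// ler_wpM2l//; exact: (aP (i, j)).1.
Qed.

Definition upper_triangular : 'B(dsum X, dsum X) :=
  BoundedOp upper_triangular_bounded.

End UpperTriangular.

(* For a complete X: the norm comes from an inner product, linear in its first
   argument. *)
Definition hilbert (R : realType) (X : completeNormedModType R[i]) : Prop :=
  exists dot : X -> X -> R[i],
    [/\ forall y, scalar (dot^~ y),
        forall x y, dot y x = (dot x y)^* &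
        forall x, `|x| ^+ 2 = dot x x].

Section Delta.
Variables (K : numFieldType) (n : nat) (X : 'I_n -> normedModType K).
Variable (D : forall i, 'B(X i, X i)).

(* Used with l the successor of k. *)
Definition Delta' (k l : 'I_n) : set K :=
  [set z | ~ isomorphic 'N(D l \-o z%:op) 'K(D k \-o z%:op)].

Definition sum_complements (k : 'I_n) (z : K) : normedModType K :=
  @dsum K {s : 'I_n | (s < k)%N} (fun s => 'K(D (sval s) \-o z%:op)).

Definition sum_kernels (k : 'I_n) (z : K) : normedModType K :=
  @dsum K {s : 'I_n | (k < s)%N} (fun s => 'N(D (sval s) \-o z%:op)).

Definition Delta_kernel (k : 'I_n) : set K :=
  [set z | strictly_embeds (sum_complements k z) 'N(D k \-o z%:op)].

Definition Delta_complement (k : 'I_n) : set K :=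
  [set z | strictly_embeds (sum_kernels k z) 'K(D k \-o z%:op)].

End Delta.

(* Main.v *)
Require Import Defs.
From HB Require Import structures.
From mathcomp Require Import all_boot all_order all_algebra.
From mathcomp Require Import complex.
From mathcomp Require Import boolp classical_sets functions reals topology.
From mathcomp Require Import normedtype.

(* Put E_i = D_i - z. Outside the two corner spectra every E_i is regular, so it
   has a generalized inverse B_i with B_i E_i = 1 - P_i and E_i B_i = 1 - Q_i,
   where P_i projects onto the kernel and Q_i onto the chosen complement of the
   range.
   If N(E_(k+1)) and K(E_k) are isomorphic for all k, put these isomorphisms,
   composed with P_(k+1), on the superdiagonal: the part of the target missed by
   E_k is hit by the kernel of E_(k+1), and the B_i together with the inverse
   isomorphisms give an explicit inverse.
   Conversely, let M be the triangular matrix with diagonal E. If S M = 1, back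
   substitution shows that the sum of the K(E_s), s < k, together with M maps onto
   the image of N(E_k) under M, so the k-th coordinate of S followed by P_k maps
   that sum onto N(E_k). If M S = 1, back substitution reconstructs from its
   kernel parts the tail (x_s), s > k, of any solution of M x = w with w in K(E_k),
   so the sum of the N(E_s), s > k, maps onto K(E_k). A bounded surjection
   excludes the relation "strictly embeds". *)

Set Implicit Arguments.
Unset Strict Implicit.
Unset Printing Implicit Defensive.

Import Order.TTheory GRing.Theory Num.Theory.
Import numFieldNormedType.Exports.

Local Open Scope classical_set_scope.
Local Open Scope ring_scope.

(** * Calculus of bounded linear maps *)

Section BoundedLinear.
Variable K : numFieldType.
Implicit Types X Y Z : normedModType K.

(** A predicate on bare functions lets explicit formulas be checked piece by piece;
    [op_of_bounded_linear] then packs them into operators. *)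
Definition bounded_linear X Y (f : X -> Y) : Prop :=
  linear f /\ exists2 M : K, 0 <= M & forall x, `|f x| <= M * `|x|.

Lemma bounded_linear_op X Y (T : 'B(X, Y)) : bounded_linear T.
Proof. by split; [exact: linearP | exact: bounded_op_bound]. Qed.

Lemma op_of_bounded_linear X Y (f : X -> Y) :
  bounded_linear f -> exists T : 'B(X, Y), T =1 f.
Proof.
move=> [fL [M M0 fM]].
pose F : {linear X -> Y} :=
  HB.pack f (GRing.isLinear.Build K X Y *:%R f fL).
by exists (BoundedOp (@bounded_near_of_bound K X Y F M M0 fM)).
Qed.

Lemma eq_bounded_linear X Y (f g : X -> Y) :
  f =1 g -> bounded_linear f -> bounded_linear g.
Proof. by move=> /funext ->. Qed.

Lemma bounded_linear_comp X Y Z (g : Y -> Z) (f : X -> Y) :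
  bounded_linear g -> bounded_linear f -> bounded_linear (fun x => g (f x)).
Proof.
move=> [gL [b b0 gb]] [fL [a a0 fa]]; split=> [l x y|].
  by rewrite fL gL.
exists (b * a) => [|x]; first exact: mulr_ge0.
by rewrite (le_trans (gb _))// -mulrA ler_wpM2l.
Qed.

Lemma bounded_linear_id X : bounded_linear (@id X).
Proof. by split=> //; exists 1 => // x; rewrite mul1r. Qed.

Lemma bounded_linear0 X Y : bounded_linear (fun _ : X => 0 : Y).
Proof.
split=> [l x y|]; first by rewrite scaler0 addr0.
by exists 0 => // x; rewrite normr0 mul0r.
Qed.

Lemma bounded_linearD X Y (f g : X -> Y) :
  bounded_linear f -> bounded_linear g -> bounded_linear (fun x => f x + g x).
Proof.
move=> [fL [a a0 fa]] [gL [b b0 gb]]; split=> [l x y|].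
  by rewrite fL gL scalerDr addrACA.
exists (a + b) => [|x]; first exact: addr_ge0.
by rewrite mulrDl (le_trans (ler_normD _ _))// lerD.
Qed.

Lemma bounded_linearN X Y (f : X -> Y) :
  bounded_linear f -> bounded_linear (fun x => - f x).
Proof.
move=> [fL [a a0 fa]]; split=> [l x y|].
  by rewrite fL opprD scalerN.
by exists a => // x; rewrite normrN.
Qed.

Lemma bounded_linearB X Y (f g : X -> Y) :
  bounded_linear f -> bounded_linear g -> bounded_linear (fun x => f x - g x).
Proof. by move=> fB gB; apply/bounded_linearD/bounded_linearN. Qed.

Lemma bounded_linear_sum X Y (I : Type) (r : seq I) (P : pred I)
    (f : I -> X -> Y) :
  (forall i, bounded_linear (f i)) ->
  bounded_linear (fun x => \sum_(i <- r | P i) f i x).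
Proof.
move=> fB; elim: r => [|i r IH].
  by apply: eq_bounded_linear (@bounded_linear0 _ _) => x; rewrite big_nil.
pose g x := if P i then f i x + \sum_(j <- r | P j) f j x
            else \sum_(j <- r | P j) f j x.
apply: (@eq_bounded_linear _ _ g) => [x|]; first by rewrite big_cons.
by rewrite /g; case: (P i) => //; apply: bounded_linearD.
Qed.

Lemma bounded_linear_val X (V : submodClosed X) :
  bounded_linear (val : subspace_type V -> X).
Proof.
split=> [l x y|]; first by rewrite linearP.
by exists 1 => // x; rewrite mul1r.
Qed.

Lemma bounded_linear_sub X Y (V : submodClosed Y) (f : X -> subspace_type V) :
  bounded_linear (fun x => val (f x)) -> bounded_linear f.
Proof.
move=> [fL fM]; split=> // l x y.
by apply: val_inj; rewrite fL linearP.
Qed.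

Section Dsum.
Variables (I : finType) (X : I -> normedModType K).

Lemma bounded_linear_coord i : bounded_linear (fun x : dsum X => x i).
Proof.
split=> // ; exists 1 => // x.
by rewrite mul1r [leRHS](bigD1 i)//= lerDl sumr_ge0.
Qed.

Lemma bounded_linear_dsum Y (f : Y -> dsum X) :
  (forall i, bounded_linear (fun y => f y i)) -> bounded_linear f.
Proof.
move=> fB; split=> [l x y|].
  by apply: functional_extensionality_dep => i; apply: (fB i).1.
have /choice[a aP] : forall i, exists M : K,
    0 <= M /\ forall y, `|f y i| <= M * `|y|.
  by move=> i; have [_ [M]] := fB i; exists M.
exists (\sum_i a i) => [|y]; first by apply: sumr_ge0 => i _; case: (aP i).
by rewrite mulr_suml; apply: ler_sum => i _; apply: (aP i).2.
Qed.

Definition dsum_inj i (v : X i) : dsum X := eqtype.dfwith (fun j => 0 : X j) v.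

Lemma dsum_inj_in i (v : X i) : dsum_inj v i = v.
Proof. exact: eqtype.dfwith_in. Qed.

Lemma dsum_inj_out i j (v : X i) : i != j -> dsum_inj v j = 0.
Proof. exact: eqtype.dfwith_out. Qed.

Lemma bounded_linear_inj i : bounded_linear (@dsum_inj i).
Proof.
apply: bounded_linear_dsum => j; have [<-|ij] := eqVneq i j.
  by apply: eq_bounded_linear (@bounded_linear_id _) => v; rewrite dsum_inj_in.
by apply: eq_bounded_linear (@bounded_linear0 _ _) => v; rewrite dsum_inj_out.
Qed.

End Dsum.

(** * Regular operators and their splittings *)

Lemma closed_range_regular X (T : 'B(X, X)) : regular T -> closed (range T).
Proof.
move=> [S TS].
have /op_of_bounded_linear[F FE] : bounded_linear (fun x => x - T (S x)).
  apply: bounded_linearB; first exact: bounded_linear_id.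
  by apply: bounded_linear_comp; apply: bounded_linear_op.
(* The projection [T S] fixes exactly the range of [T]. *)
have -> : range T = F @^-1` [set 0].
  apply/seteqP; split=> [_ [x _ <-]|x] /=; rewrite FE.
    by rewrite -TS subrr.
  by move/eqP; rewrite subr_eq0 => /eqP ->; exists (S x).
apply: closed_comp; last first.
  exact/accessible_closed_set1/hausdorff_accessible/norm_hausdorff.
by move=> x _; exact: (linear_bounded_continuous F).1 (bounded_opP F) x.
Qed.

(** The inverse is normalized: [ginv] vanishes on the chosen complement and has values in the kernel
    of [ker_proj]. This makes cross terms vanish once off-diagonal entries are added. *)
Record regular_splitting X (T : 'B(X, X)) := RegularSplitting {
  ginv : 'B(X, X);
  ker_proj : 'B(X, 'N(T));
  coker_proj : 'B(X, 'K(T));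
  ginv_op : forall x, ginv (T x) = x - val (ker_proj x);
  op_ginv : forall x, T (ginv x) = x - val (coker_proj x);
  ker_proj_ginv : forall x, ker_proj (ginv x) = 0;
  ginv_coker : forall w : 'K(T), ginv (val w) = 0;
  ker_projK : forall v, ker_proj (val v) = v;
  coker_projK : forall w, coker_proj (val w) = w;
  coker_proj_op : forall x, coker_proj (T x) = 0 }.

Lemma kernelE X Y (T : 'B(X, Y)) (v : 'N(T)) : T (val v) = 0.
Proof. exact/eqP/(valP v). Qed.

(** The range is closed, so the closure in [range_complement] disappears; the kernel of the
    projection [T S] is a complement, so the default branch never occurs. *)
Lemma range_complementP X (T : 'B(X, X)) :
  regular T -> topological_complement (range T) (range_complement T).
Proof.
move=> Treg; have Tcl := closed_range_regular Treg.
rewrite /range_complement; case: pselect => [exW|[]].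
  by case: (cid exW) => /= W; rewrite -(closure_id _).1.
rewrite -(closure_id _).1//; have [S TS] := Treg.
have /op_of_bounded_linear[F FE] : bounded_linear (fun x => T (S x)).
  by apply: bounded_linear_comp; apply: bounded_linear_op.
exists (kernel F); split=> [_ [x _ <-]|].
  by rewrite unfold_in /kernel_pred /= FE -TS => /eqP.
exists F => x; split; first by rewrite FE; exists (S x).
by rewrite unfold_in /kernel_pred /= linearB !FE -TS subrr.
Qed.

(** The form [exists _, True] puts a record of data into [Prop]; [cid] extracts it later. *)
Lemma regular_splittingP X (T : 'B(X, X)) :
  regular T -> exists _ : regular_splitting T, True.
Proof.
move=> Treg; have [S TS] := Treg.
have [TW [P PP]] := range_complementP Treg.
have TB := bounded_linear_op T; have SB := bounded_linear_op S.
have PB := bounded_linear_op P; have iB := @bounded_linear_id X.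
have kerP x : x - S (T x) \in kernel T.
  by rewrite unfold_in /kernel_pred /= linearB -TS subrr.
have /op_of_bounded_linear[p pE] : bounded_linear
    (fun x => exist (fun y => y \in kernel T) _ (kerP x) : 'N(T)).
  apply: bounded_linear_sub => /=; apply: bounded_linearB => //.
  exact: bounded_linear_comp.
have /op_of_bounded_linear[q qE] : bounded_linear
    (fun x => exist (fun y => y \in range_complement T) _ (PP x).2 : 'K(T)).
  by apply: bounded_linear_sub => /=; apply: bounded_linearB.
(* In [S T S P] the factor [P] kills the chosen complement, and the leading [S T] puts the values in
   the kernel of the projection [1 - S T]. *)
have /op_of_bounded_linear[B BE] : bounded_linear
    (fun x => S (T (S (P x)))).
  by do 3 apply: bounded_linear_comp => //.
have PT x : P (T x) = T x.
  apply/eqP; rewrite eq_sym -subr_eq0; apply/eqP.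
  apply: TW; last exact: (PP _).2.
  by have [[y _ <-] _] := PP (T x); exists (x - y); rewrite ?linearB.
have TSP x : T (S (P x)) = P x by have [[y _ <-] _] := PP x; rewrite -TS.
(* [P w] lies in the range, and also in the complement as [w - (w - P w)]. *)
have PW (w : 'K(T)) : P (val w) = 0.
  apply: TW; first exact: (PP _).1.
  have -> : P (val w) = val (w - q (val w)).
    by rewrite linearB qE /= opprB addrC subrK.
  exact: valP.
unshelve eexists (@RegularSplitting X T B p q _ _ _ _ _ _ _) => //.
- by move=> x; rewrite BE pE /= PT -TS opprB addrC subrK.
- by move=> x; rewrite BE qE /= -TS TSP opprB addrC subrK.
- by move=> x; apply: val_inj; rewrite pE BE /= -TS subrr.
- by move=> w; rewrite BE PW !linear0.
- by move=> v; apply: val_inj; rewrite pE /= kernelE linear0 subr0.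
- by move=> w; apply: val_inj; rewrite qE /= PW subr0.
- by move=> x; apply: val_inj; rewrite qE /= PT subrr.
Qed.

End BoundedLinear.

(** * Extension by zero from a subfamily of subspaces *)

Section Extension.
Variables (K : numFieldType) (I : finType) (X : I -> normedModType K).
Variables (P : pred I) (V : forall i, submodClosed (X i)).

Definition dsum_ext
    (c : @dsum K {i | P i} (fun t => subspace_type (V (sval t)))) : dsum X :=
  fun i => if pselect (P i) is left Pi then val (c (exist _ i Pi)) else 0.

Lemma dsum_ext_in c i (Pi : P i) : dsum_ext c i = val (c (exist _ i Pi)).
Proof.
by rewrite /dsum_ext; case: pselect => // Pi'; rewrite (bool_irrelevance Pi' Pi).
Qed.

Lemma dsum_ext_out c i : ~~ P i -> dsum_ext c i = 0.
Proof. by rewrite /dsum_ext; case: pselect => // Pi /negP. Qed.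

Lemma bounded_linear_ext : bounded_linear dsum_ext.
Proof.
apply: bounded_linear_dsum => i; have [Pi|nPi] := boolP (P i).
  have := bounded_linear_comp (@bounded_linear_val _ _ (V i))
    (@bounded_linear_coord _ _ (fun t : {i | P i} => subspace_type (V (sval t)))
      (exist _ i Pi)).
  by apply: eq_bounded_linear => c; rewrite dsum_ext_in.
by apply: eq_bounded_linear (@bounded_linear0 _ _ _) => c; rewrite dsum_ext_out.
Qed.

End Extension.

Lemma dsumB (K : numFieldType) (I : finType) (X : I -> normedModType K)
  (x y : dsum X) i : (x - y) i = x i - y i.
Proof. by []. Qed.

(** * Back substitution as a fixed point *)

Section StrictlyUpper.
Variables (K : numFieldType) (n : nat) (X : 'I_n -> normedModType K).

(* Back substitution: the value of F at s depends only on the coordinates after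
   s, so n iterations reach the fixed point. *)
Definition strictly_upper (F : dsum X -> dsum X) : Prop :=
  forall (s : 'I_n) x y, (forall j : 'I_n, (s < j)%N -> x j = y j) ->
    F x s = F y s.

Lemma strictly_upper_iter F x0 :
  strictly_upper F -> F (iter n F x0) = iter n F x0.
Proof.
(* After m iterations the last m coordinates are already stable. *)
move=> FU; suff H m (s : 'I_n) : (n <= s + m)%N ->
    F (iter m F x0) s = iter m F x0 s.
  by apply: functional_extensionality_dep => s; rewrite H// leq_addl.
elim: m s => [|m IH] s sm; first by rewrite addn0 leqNgt ltn_ord in sm.
apply: FU => j sj; apply: IH.
by rewrite (leq_trans sm)// addnS -addSn leq_add2r.
Qed.

(** [F] at s reads only later coordinates, so agreement propagates from the last coordinate down to
    k + 1, whatever happens in the rows up to k. *)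
Lemma strictly_upper_fixed_unique F x0 x k : strictly_upper F ->
  (forall s : 'I_n, (k < s)%N -> F x s = x s) ->
  forall s : 'I_n, (k < s)%N -> iter n F x0 s = x s.
Proof.
move=> FU Fx; suff H m (s : 'I_n) : (n <= s + m)%N -> (k < s)%N ->
    iter m F x0 s = x s.
  by move=> s; apply: H; rewrite leq_addl.
elim: m s => [|m IH] s sm ks; first by rewrite addn0 leqNgt ltn_ord in sm.
rewrite -Fx//=; apply: FU => j sj; apply: IH; last exact: ltn_trans sj.
by rewrite (leq_trans sm)// addnS -addSn leq_add2r.
Qed.

End StrictlyUpper.

(** * Surjections obtained from one-sided inverses of a triangular matrix *)

Section Triangular.
Variables (K : numFieldType) (n : nat) (X : 'I_n -> normedModType K).
Variables (E : forall i, 'B(X i, X i)) (A : forall i j, 'B(X j, X i)).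
Local Notation M := (upper_triangular E A).
Local Notation upper i x := (\sum_(j < n | (i < j)%N) A i j (x j)).

Lemma upper_triangularE x i : M x i = E i (x i) + upper i x.
Proof. by []. Qed.

Lemma upper_triangular_inj k (v : X k) (i : 'I_n) : (k <= i)%N ->
  M (dsum_inj v) i = E i (dsum_inj v i).
Proof.
move=> ki; rewrite upper_triangularE big1 ?addr0// => j ij.
by rewrite dsum_inj_out ?linear0// neq_ltn (leq_ltn_trans ki ij).
Qed.

Hypothesis splitE : forall i, regular_splitting (E i).
Let B i := ginv (splitE i).
Let P i := ker_proj (splitE i).
Let Q i := coker_proj (splitE i).

(** Let y be the image under M of v placed in position k. Applying S to [y = M x + ext c] shows that
    [S (ext c)] is v in position k minus x; since x vanishes from k on, coordinate k is v, which
    [P k] fixes. *)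
Lemma left_invertible_surjection (k : 'I_n) : left_invertible M ->
  exists T : 'B(@dsum K {s : 'I_n | (s < k)%N} (fun s => 'K(E (sval s))),
                'N(E k)),
    range T = setT.
Proof.
move=> [S SM].
pose ext := @dsum_ext _ _ X (fun s : 'I_n => (s < k)%N)
  (fun s => range_complement (E s)).
have /op_of_bounded_linear[T TE] : bounded_linear (fun c => P k (S (ext c) k)).
  have extB : bounded_linear ext by exact: bounded_linear_ext.
  have SB := bounded_linear_comp (bounded_linear_op S) extB.
  have SkB := bounded_linear_comp (@bounded_linear_coord _ _ X k) SB.
  exact: (bounded_linear_comp (bounded_linear_op (P k)) SkB).
exists T; apply/seteqP; split=> // v _ /=.
pose y := M (dsum_inj (val v)).
have y0 (s : 'I_n) : (k <= s)%N -> y s = 0.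
  move=> ks; rewrite /y upper_triangular_inj//.
  have [ks'|ks'] := eqVneq k s; last by rewrite dsum_inj_out// linear0.
  by case: _ / ks'; rewrite dsum_inj_in kernelE.
(* The fixed point x of F solves the first k rows of M x = y up to elements of
   the complements K(E s). *)
pose F (x : dsum X) : dsum X := fun s =>
  if (s < k)%N then B s (y s - upper s x) else 0.
have FU : strictly_upper F.
  move=> s x x' xx'; rewrite /F; case: ifP => // _; congr (B s (_ - _)).
  by apply: eq_bigr => j /xx' ->.
pose x := iter n F 0; have Fx : F x = x by exact: strictly_upper_iter.
have x0 (s : 'I_n) : (k <= s)%N -> x s = 0.
  by move=> ks; rewrite -Fx /F ltnNge ks.
(* As [E s (B s r) = r - Q s r], this c records what [E s] misses of the right-hand side r of row
   s. *)
pose c : @dsum K {s : 'I_n | (s < k)%N} (fun s => 'K(E (sval s))) :=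
  fun t => Q (sval t) (y (sval t) - upper (sval t) x).
have yE : y = M x + ext c.
  apply: functional_extensionality_dep => s.
  rewrite -[RHS]/(M x s + ext c s) upper_triangularE.
  have [sk|ks] := ltnP s k.
    rewrite /ext (dsum_ext_in _ sk) /= /c /=.
    have -> : x s = B s (y s - upper s x) by rewrite -{1}Fx /F sk.
    by rewrite op_ginv -/(Q s) addrAC subrK subrK.
  rewrite /ext dsum_ext_out -?leqNgt// x0// linear0 y0// add0r addr0.
  by rewrite big1// => j sj; rewrite x0 ?linear0// (leq_trans ks)// ltnW.
exists c => //; rewrite TE.
have -> : ext c = y - M x by rewrite yE addrAC subrr add0r.
rewrite linearB !SM dsumB dsum_inj_in x0// subr0.
by rewrite /P ker_projK.
Qed.

(** In the rows s > k of [M x = w], applying [B s] gives [x s = P s (x s) - B s (upper s x)], so the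
    kernel parts determine the tail. Row k says [upper k x = w - E k (x k)], which [Q k] sends to
    w. *)
Lemma right_invertible_surjection (k : 'I_n) : right_invertible M ->
  exists T : 'B(@dsum K {s : 'I_n | (k < s)%N} (fun s => 'N(E (sval s))),
                'K(E k)),
    range T = setT.
Proof.
move=> [S MS].
pose ext := @dsum_ext _ _ X (fun s : 'I_n => (k < s)%N) (fun s => kernel (E s)).
pose F u (x : dsum X) : dsum X := fun s => ext u s - B s (upper s x).
have FU u : strictly_upper (F u).
  move=> s x x' xx'; rewrite /F; congr (_ - B s _).
  by apply: eq_bigr => j /xx' ->.
have upperB (i : 'I_n) : bounded_linear (fun x : dsum X => upper i x).
  apply: bounded_linear_sum => j.
  exact: (bounded_linear_comp (bounded_linear_op (A i j))
    (@bounded_linear_coord _ _ X j)).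
(* The start is 0 and [F u x] is jointly linear in u and x, so every iterate is linear in u. *)
have iterB m : bounded_linear (fun u => iter m (F u) (0 : dsum X)).
  elim: m => [|m IH]; first exact: bounded_linear0.
  apply: bounded_linear_dsum => s; apply: bounded_linearB.
    have extB : bounded_linear ext by exact: bounded_linear_ext.
    exact: (bounded_linear_comp (@bounded_linear_coord _ _ X s) extB).
  have uB := bounded_linear_comp (upperB s) IH.
  exact: (bounded_linear_comp (bounded_linear_op (B s)) uB).
have /op_of_bounded_linear[T TE] :
    bounded_linear (fun u => Q k (upper k (iter n (F u) (0 : dsum X)))).
  have uB := bounded_linear_comp (upperB k) (iterB n).
  exact: (bounded_linear_comp (bounded_linear_op (Q k)) uB).
exists T; apply/seteqP; split=> // w _ /=.
pose x := S (dsum_inj (val w)).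
have Mx i : E i (x i) + upper i x = dsum_inj (val w) i.
  by rewrite -upper_triangularE MS.
pose u : @dsum K {s : 'I_n | (k < s)%N} (fun s => 'N(E (sval s))) :=
  fun t => P (sval t) (x (sval t)).
exists u => //; rewrite TE.
have xE (s : 'I_n) : (k < s)%N -> iter n (F u) (0 : dsum X) s = x s.
  apply: strictly_upper_fixed_unique => // {}s ks; rewrite /F /ext.
  rewrite (dsum_ext_in _ ks) /= /u /=.
  have /eqP := Mx s; rewrite dsum_inj_out ?neq_ltn ?ks// addr_eq0 => /eqP Es.
  by rewrite -linearN -Es ginv_op -/(P s) addrC subrK.
have -> : upper k (iter n (F u) (0 : dsum X)) = upper k x.
  by apply: eq_bigr => j /xE ->.
have -> : upper k x = val w - E k (x k).
  by rewrite -(dsum_inj_in (val w)) -Mx addrAC subrr add0r.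
by rewrite linearB /Q coker_projK coker_proj_op subr0.
Qed.

End Triangular.

(** * Corner entries of one-sided invertible matrices *)

Section Corners.
Variables (K : numFieldType) (n : nat) (X : 'I_n.+1 -> normedModType K).
Variables (E : forall i, 'B(X i, X i)) (A : forall i j, 'B(X j, X i)).

(** The first column of the matrix has only its diagonal entry, so the same corner of [S] is a left
    inverse of that entry. *)
Lemma left_invertible_corner :
  left_invertible (upper_triangular E A) -> left_invertible (E ord0).
Proof.
move=> [S SM].
have /op_of_bounded_linear[T TE] :
    bounded_linear (fun v : X ord0 => S (dsum_inj v) ord0).
  have SB := bounded_linear_comp (bounded_linear_op S)
    (@bounded_linear_inj _ _ X ord0).
  exact: (bounded_linear_comp (@bounded_linear_coord _ _ X ord0) SB).
exists T => v; rewrite TE.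
have -> : dsum_inj (E ord0 v) = upper_triangular E A (dsum_inj v).
  apply: functional_extensionality_dep => i; rewrite upper_triangular_inj//.
  have [i0|i0] := eqVneq ord0 i; last by rewrite !dsum_inj_out// linear0.
  by case: _ / i0; rewrite !dsum_inj_in.
by rewrite SM dsum_inj_in.
Qed.

(** Dually, the last row of the matrix has only its diagonal entry. *)
Lemma right_invertible_corner :
  right_invertible (upper_triangular E A) -> right_invertible (E ord_max).
Proof.
move=> [S MS].
have /op_of_bounded_linear[T TE] :
    bounded_linear (fun v : X ord_max => S (dsum_inj v) ord_max).
  have SB := bounded_linear_comp (bounded_linear_op S)
    (@bounded_linear_inj _ _ X ord_max).
  exact: (bounded_linear_comp (@bounded_linear_coord _ _ X ord_max) SB).
exists T => v; rewrite TE -[RHS](dsum_inj_in v) -[in RHS](MS (dsum_inj v)).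
rewrite upper_triangularE.
by rewrite big_pred0 ?addr0// => j; rewrite ltnNge -ltnS ltn_ord.
Qed.

End Corners.

(** * Construction of an invertible completion *)

Section Completion.
Variables (K : numFieldType) (n : nat) (X : 'I_n.+1 -> normedModType K).
Variables (E : forall i, 'B(X i, X i)).
Hypothesis splitE : forall i, regular_splitting (E i).
Let B i := ginv (splitE i).
Let P i := ker_proj (splitE i).
Let Q i := coker_proj (splitE i).

(** For j = i + 1, [sdiag] will be the isomorphism after [P j] and [sdiag_inv] its inverse after
    [Q i]. Admitting all (i, j), with zero maps elsewhere, lets both be chosen as full matrices. *)
Record superdiagonal_pair (i j : 'I_n.+1) := SuperdiagonalPair {
  sdiag : 'B(X j, X i);
  sdiag_inv : 'B(X i, X j);
  sdiag_ginv : forall x, sdiag (B j x) = 0;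
  sdiag_inv_op : forall x, sdiag_inv (E i x) = 0;
  ginv_sdiag : forall x, B i (sdiag x) = 0;
  op_sdiag_inv : forall x, E j (sdiag_inv x) = 0;
  sdiag_off : j != i.+1 :> nat -> forall x, sdiag x = 0;
  sdiag_inv_off : j != i.+1 :> nat -> forall x, sdiag_inv x = 0;
  sdiagK : j = i.+1 :> nat -> forall x, sdiag_inv (sdiag x) = val (P j x);
  sdiag_invK : j = i.+1 :> nat -> forall x, sdiag (sdiag_inv x) = val (Q i x) }.

Lemma superdiagonal_pairP (i j : 'I_n.+1) :
  (j = i.+1 :> nat -> isomorphic 'N(E j) 'K(E i)) ->
  exists _ : superdiagonal_pair i j, True.
Proof.
move=> iso; have [ji|ji] := eqVneq (j : nat) i.+1; last first.
  have [Z ZE] := op_of_bounded_linear (@bounded_linear0 _ (X j) (X i)).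
  have [Z' Z'E] := op_of_bounded_linear (@bounded_linear0 _ (X i) (X j)).
  unshelve eexists (@SuperdiagonalPair i j Z Z' _ _ _ _ _ _ _ _) => //;
    first [ by move=> x; rewrite ?ZE ?Z'E ?linear0
          | by move=> _ x; rewrite ?ZE ?Z'E | by move/eqP; rewrite (negbTE ji) ].
have [J [[J' J'J] [J'' JJ'']]] := iso ji.
(* A left inverse of a right invertible map is two-sided. *)
have JJ' w : J (J' w) = w by rewrite -[w]JJ'' J'J.
have JB := bounded_linear_comp (bounded_linear_op J) (bounded_linear_op (P j)).
have J'B := bounded_linear_comp (bounded_linear_op J') (bounded_linear_op (Q i)).
have [a aE] := op_of_bounded_linear
  (bounded_linear_comp (@bounded_linear_val _ _ _) JB).
have [c cE] := op_of_bounded_linear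
  (bounded_linear_comp (@bounded_linear_val _ _ _) J'B).
unshelve eexists (@SuperdiagonalPair i j a c _ _ _ _ _ _ _ _) => //.
- by move=> x; rewrite aE /P ker_proj_ginv !linear0.
- by move=> x; rewrite cE /Q coker_proj_op !linear0.
- by move=> x; rewrite aE /B ginv_coker.
- by move=> x; rewrite cE kernelE.
- by rewrite ji eqxx.
- by rewrite ji eqxx.
- by move=> _ x; rewrite cE aE /Q coker_projK J'J.
- by move=> _ x; rewrite aE cE /P ker_projK JJ'.
Qed.

(** The inverse [N] is lower bidiagonal, with [B] on the diagonal and [C] below it. Since [B A = 0]
    and [C E = 0], coordinate j of [N M] is [(1 - P j) + P j]; since [A B = 0] and [E C = 0],
    coordinate i of [M N] is [(1 - Q i) + Q i]. *)
Lemma invertible_completion :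
  left_invertible (E ord0) -> right_invertible (E ord_max) ->
  (forall i j : 'I_n.+1, j = i.+1 :> nat -> isomorphic 'N(E j) 'K(E i)) ->
  exists A : forall i j, 'B(X j, X i), invertible (upper_triangular E A).
Proof.
move=> [L LE] [R ER] iso.
pose AC i j := sval (cid (superdiagonal_pairP (@iso i j))).
pose A i j := sdiag (AC i j); pose C i j := sdiag_inv (AC i j).
exists A; pose N (y : dsum X) : dsum X :=
  fun j => B j (y j) + \sum_i C i j (y i).
have /op_of_bounded_linear[T TE] : bounded_linear N.
  apply: bounded_linear_dsum => j; apply: bounded_linearD.
    exact: (bounded_linear_comp (bounded_linear_op (B j))
      (@bounded_linear_coord _ _ X j)).
  apply: bounded_linear_sum => i.
  exact: (bounded_linear_comp (bounded_linear_op (C i j))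
    (@bounded_linear_coord _ _ X i)).
(* Row 0 of [N] has no subdiagonal entry to restore this kernel part; injectivity of [E ord0] makes
   it zero. *)
have P0 x : val (P ord0 x) = 0.
  by rewrite -[LHS]LE kernelE linear0.
(* The last row of the matrix has no superdiagonal entry; surjectivity of [E ord_max]
   compensates. *)
have Qmax x : val (Q ord_max x) = 0.
  by rewrite -[x]ER /Q coker_proj_op.
have CM x (i j : 'I_n.+1) : C i j (upper_triangular E A x i) =
    if j == i.+1 :> nat then val (P j (x j)) else 0.
  have [ji|ji] := eqVneq (j : nat) i.+1; last by rewrite /C sdiag_inv_off.
  rewrite upper_triangularE linearD /C sdiag_inv_op add0r.
  rewrite (bigD1 j) ?ji//= linearD sdiagK// big1 ?linear0 ?addr0//.
  by move=> k /andP[_ kj]; rewrite /A sdiag_off// -ji.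
have AN y (i j : 'I_n.+1) : A i j (N y j) =
    if j == i.+1 :> nat then val (Q i (y i)) else 0.
  have [ji|ji] := eqVneq (j : nat) i.+1; last by rewrite /A sdiag_off.
  rewrite /N linearD /A sdiag_ginv add0r.
  rewrite (bigD1 i)//= linearD sdiag_invK// big1 ?linear0 ?addr0//.
  by move=> k ki; rewrite /C sdiag_inv_off// ji eqSS eq_sym.
split.
  exists T => x; rewrite TE; apply: functional_extensionality_dep => j.
  rewrite /N upper_triangularE linearD linear_sum big1 => [|k _]; last first.
    by rewrite /A /B ginv_sdiag.
  rewrite addr0 /B ginv_op -/(P j) (eq_bigr _ (fun i _ => CM x i j)).
  suff -> : \sum_(i < n.+1) (if j == i.+1 :> nat then val (P j (x j)) else 0) =
      val (P j (x j)) by rewrite subrK.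
  have [j0|j0] := posnP j.
    rewrite big1 => [|i _]; last by rewrite j0.
    by have -> : j = ord0; [exact: val_inj | rewrite P0].
  (* For j > 0 the only contributing index is j - 1. *)
  have jE : j.-1.+1 = j := prednK j0.
  have jn : (j.-1 < n.+1)%N by rewrite jE ltnW.
  rewrite (bigD1 (Ordinal jn))//= jE eqxx big1 ?addr0// => i ij.
  case: eqVneq => // ji; case/eqP: ij; apply: val_inj => /=.
  by rewrite ji.
exists T => y; rewrite TE; apply: functional_extensionality_dep => i.
rewrite upper_triangularE (eq_bigr _ (fun j _ => AN y i j)).
rewrite /N linearD linear_sum big1 => [|k _]; last by rewrite /C op_sdiag_inv.
rewrite addr0 /B op_ginv -/(Q i).
suff -> : \sum_(j < n.+1 | (i < j)%N)
    (if j == i.+1 :> nat then val (Q i (y i)) else 0) = val (Q i (y i)).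
  by rewrite subrK.
have [im|im] := ltnP i n; last first.
  have -> : i = ord_max by apply/val_inj/eqP; rewrite eqn_leq -ltnS ltn_ord.
  by rewrite Qmax big1// => j _; case: ifP.
have im' : (i.+1 < n.+1)%N by [].
rewrite (bigD1 (Ordinal im'))//= eqxx big1 ?addr0// => j /andP[_ ij].
by case: eqVneq => // ji; case/eqP: ij; apply: val_inj.
Qed.

End Completion.

(** * Signs: the spectra use z - T, the kernels and complements D - z *)

Section Opposite.
Variables (K : numFieldType) (X Y : normedModType K) (S T : 'B(X, Y)).
Hypothesis ST : forall x, S x = - T x.

Lemma left_invertible_opp : left_invertible S -> left_invertible T.
Proof.
move=> [U US].
have [V VE] := op_of_bounded_linear (bounded_linearN (bounded_linear_op U)).
by exists V => x; rewrite VE -linearN -ST US.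
Qed.

Lemma right_invertible_opp : right_invertible S -> right_invertible T.
Proof.
move=> [U SU].
have [V VE] := op_of_bounded_linear (bounded_linearN (bounded_linear_op U)).
by exists V => x; rewrite VE linearN -ST SU.
Qed.

End Opposite.

Section Regular.
Variables (K : numFieldType) (X : normedModType K) (T : 'B(X, X)).

Lemma left_invertible_regular : left_invertible T -> regular T.
Proof. by move=> [S ST]; exists S => x; rewrite ST. Qed.

Lemma right_invertible_regular : right_invertible T -> regular T.
Proof. by move=> [S TS]; exists S => x; rewrite TS. Qed.

End Regular.

(** A surjective range has codimension 0, witnessed by the empty family. *)
Lemma not_strictly_embeds_surj (K : numFieldType) (X Y : normedModType K)
  (T : 'B(X, Y)) : range T = setT -> ~ strictly_embeds X Y.
Proof.
move=> Tsurj [_ /(_ T)]; apply; rewrite Tsurj.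
by exists 0, (fun=> 0) => x; exists (fun=> 0).
Qed.

Lemma resolvent_opp (K : numFieldType) (X : normedModType K) (T : 'B(X, X)) z x :
  (z%:op \-o T) x = - (T \-o z%:op) x.
Proof. by rewrite /= opprB. Qed.

(** The sign is taken out of the whole matrix, so [A] is the same on both sides. *)
Lemma upper_triangular_resolvent (K : numFieldType) n
    (X : 'I_n -> normedModType K) (D : forall i, 'B(X i, X i))
    (A : forall i j, 'B(X j, X i)) z x :
  (z%:op \-o upper_triangular D A) x =
  - upper_triangular (fun i => D i \-o z%:op) A x.
Proof.
rewrite resolvent_opp; congr (- _); apply: functional_extensionality_dep => i.
by rewrite upper_triangularE /= addrAC.
Qed.

(* The number of spaces is n.+2; they are indexed by 'I_n.+2, from 0 to n.+1. *)
Theorem corollary2p14 (R : realType) (n : nat)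
    (X : 'I_n.+2 -> completeNormedModType R[i])
    (D : forall i, 'B(X i, X i))
    (Dregular : forall s : 'I_n.+2, (0 < s < n.+1)%N ->
       forall z : R[i], regular (D s \-o z%:op)) :
  (\bigcap_(A in [set: forall i j, 'B(X j, X i)]) spectrum (upper_triangular D A)
     `<=` left_spectrum (D ord0) `|` right_spectrum (D ord_max)
          `|` \bigcup_(k < n.+1) Delta' D (inord k) (inord k.+1))
  /\
  ((forall i, hilbert (X i) /\ ~ finite_dim (X i)) ->
   left_spectrum (D ord0) `|` right_spectrum (D ord_max)
     `|` \bigcup_(k in [set k : 'I_n.+2 | (0 < k < n.+1)%N])
           (Delta_kernel D k `|` Delta_complement D k)
     `|` (Delta_kernel D ord_max `|` Delta_complement D ord0)
   `<=` \bigcap_(A in [set: forall i j, 'B(X j, X i)])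
          spectrum (upper_triangular D A)).
Proof.
(* Regularity comes from one-sided invertibility at the two corners and from the hypothesis in
   between. *)
have split z : left_invertible (D ord0 \-o z%:op) ->
    right_invertible (D ord_max \-o z%:op) ->
    forall i, exists _ : regular_splitting (D i \-o z%:op), True.
  move=> DL DR i; apply: regular_splittingP.
  have [i0|i0] := posnP i.
    have -> : i = ord0 by exact: val_inj.
    exact: left_invertible_regular.
  have [im|im] := ltnP i n.+1; first by apply: Dregular; rewrite i0.
  have -> : i = ord_max by apply/val_inj/eqP; rewrite eqn_leq -ltnS ltn_ord.
  exact: right_invertible_regular.
split=> [z zA|_ z zD A _ [ML MR]].
  apply: contrapT => zD; pose E i := D i \-o z%:op.
  have EL : left_invertible (E ord0).
    apply: contrapT => EL; apply: zD; do 2 left; move=> DL; apply: EL.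
    by apply: left_invertible_opp DL; exact: resolvent_opp.
  have ER : right_invertible (E ord_max).
    apply: contrapT => ER; apply: zD; left; right; move=> DR; apply: ER.
    by apply: right_invertible_opp DR; exact: resolvent_opp.
  have iso (i j : 'I_n.+2) : j = i.+1 :> nat -> isomorphic 'N(E j) 'K(E i).
    (* The union runs over naturals k < n + 1; k = i qualifies because i + 1 = j, and [inord] gives
       back i and j. *)
    move=> ji; apply: contrapT => niso; apply: zD; right; exists i.
      by rewrite /= -ltnS -ji.
    by rewrite inord_val -ji inord_val.
  have [A [AL AR]] := invertible_completion (fun i => sval (cid (split z EL ER i)))
    EL ER iso.
  have opp x : upper_triangular E A x = - (z%:op \-o upper_triangular D A) x.
    by rewrite upper_triangular_resolvent opprK.
  (* This [A], built for the single point z, contradicts membership of z in the intersection. *)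
  by apply: (zA A I); split; [exact: left_invertible_opp AL
                             | exact: right_invertible_opp AR].
pose E i := D i \-o z%:op.
have {}ML := left_invertible_opp (upper_triangular_resolvent D A z) ML.
have {}MR := right_invertible_opp (upper_triangular_resolvent D A z) MR.
have EL : left_invertible (E ord0) by exact: left_invertible_corner ML.
have ER : right_invertible (E ord_max) by exact: right_invertible_corner MR.
have splitE i : regular_splitting (E i) := sval (cid (split z EL ER i)).
(* Proved for every k, so that it covers both the middle indices and [ord_max]; likewise [ncoker]
   covers [ord0]. *)
have nker k : ~ Delta_kernel D k z.
  have [T Tsurj] := left_invertible_surjection splitE k ML.
  exact: not_strictly_embeds_surj Tsurj.
have ncoker k : ~ Delta_complement D k z.
  have [T Tsurj] := right_invertible_surjection splitE k MR.
  exact: not_strictly_embeds_surj Tsurj.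
have oppE i x : E i x = - (z%:op \-o D i) x by rewrite resolvent_opp opprK.
case: zD => [[[zL|zR]|[k _]]|]; last 2 first.
- by case; [exact: nker | exact: ncoker].
- by case; [exact: nker | exact: ncoker].
- by apply: zL; apply: left_invertible_opp EL.
- by apply: zR; apply: right_invertible_opp ER.
Qed.
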